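(* Consider the randomized procedure $\mathfrak{h}_2$ described in the context, run on $D=\{\mathbf{v}_1,\dots,\mathbf{v}_q\}$ with parameters $\varepsilon,\eta$ and $T=d^2$ iterations, producing $P_{\mathrm{avg}}=\frac1T\sum_{t=1}^T P_t$. Then $\mathbb{E}\left[\max_{i\in[d]}\left|\frac1q w(D,i)-\sqrt{\tfrac{2}{d}}\,\frac1q\, w(P_{\mathrm{avg}},i)\right|\right]\le 2\sqrt{\frac{2\log(2/\eta)}{d^2}}+11\sqrt2\,\frac{\log d}{q\varepsilon\sqrt d}+\frac4d+2d\exp(-q/4)+\eta,$ where the expectation is over all randomness of the procedure (quantization, coordinate sampling and Laplace noise).
   Context: Let $d\ge1$, $\eta>0$ with $2/\eta$ an integer, $S=\{-1,-1+\eta,\dots,1-\eta,1\}$. Let $D=\{\mathbf{v}_1,\dots,\mathbf{v}_q\}\subset\mathbb{R}^{d}$ with all coordinates $v_{ji}\in[-\sqrt{2/d},\sqrt{2/d}]$, and let $w(D,i)=\sum_{j=1}^q v_{ji}$. Quantization: for $x\in[-1,1]$ let $k=\lfloor (x+1)/\eta\rfloor$ and let $Q(x)=-1+k\eta$ with probability $\frac{(k+1)\eta-1-x}{\eta}$ and $Q(x)=-1+(k+1)\eta$ with probability $\frac{x+1-k\eta}{\eta}$, independently across applications; $Q$ acts coordinatewise. Let $D_Q=\{\tilde v_j=Q(\sqrt{d/2}\,\mathbf{v}_j)\}_{j=1}^q$ and $w(D_Q,i)=\sum_j\tilde v_{ji}$. For a distribution $P$ on $S^{d}$ with $i$-th marginal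 $P_i$, $w(P,i)=q\sum_{s\in S}sP_i(s)$. Let $P_0$ be uniform on $S^{d}$. For $t=1,\dots,T$: sample $i(t)\in[d]$ with probability proportional to $\exp(\varepsilon|w(P_{t-1},i)-w(D_Q,i)|)$; set $\mu_{i(t)}=w(D_Q,i(t))+\mathrm{Lap}(1/\varepsilon)$; set $P_t(\mathbf{s})\propto P_{t-1}(\mathbf{s})\exp\big(s_{i(t)}(\mu_{i(t)}-w(P_{t-1},i(t)))/(2q)\big)$. Finally $P_{\mathrm{avg}}=\frac1T\sum_{t=1}^TP_t$ and the output of $\mathfrak{h}_2$ is $\sqrt{2/d}\,\frac1q(w(P_{\mathrm{avg}},1),\dots,w(P_{\mathrm{avg}},d))$. *)

(* Defs.v *)
From HB Require Import structures.
From mathcomp Require Import all_boot all_order all_algebra.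
From mathcomp Require Import all_classical all_reals all_analysis.
Set Implicit Arguments. Unset Strict Implicit. Unset Printing Implicit Defensive.
Import Order.TTheory GRing.Theory Num.Theory.
Import numFieldNormedType.Exports.
Local Open Scope ring_scope.

Section H2.
Variable R : realType.

(* The grid S = {-1, -1+eta, ..., 1}, with m = 2/eta; index k : 'I_m.+1 stands for -1 + k*eta *)
Definition Sval (eta : R) (m : nat) (k : 'I_m.+1) : R := -1 + k%:R * eta.

Definition pt (d m : nat) := {ffun 'I_d -> 'I_m.+1}.

Definition marg (d m : nat) (P : pt d m -> R) (i : 'I_d) (s : 'I_m.+1) : R :=
  \sum_(x : pt d m | x i == s) P x.

Definition wP (eta : R) (q d m : nat) (P : pt d m -> R) (i : 'I_d) : R :=
  q%:R * \sum_(s : 'I_m.+1) Sval eta s * marg P i s.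

Definition P0 (d m : nat) : pt d m -> R := fun _ => #|{: pt d m}|%:R^-1.

Definition wD (q d : nat) (v : 'I_q -> 'I_d -> R) (i : 'I_d) : R := \sum_(j < q) v j i.

Definition qk (eta x : R) : R := (Num.floor ((x + 1) / eta))%:~R.
Definition Qval (eta x : R) (up : bool) : R :=
  if up then -1 + (qk eta x + 1) * eta else -1 + qk eta x * eta.
Definition Qprob (eta x : R) (up : bool) : R :=
  if up then (x + 1 - qk eta x * eta) / eta else ((qk eta x + 1) * eta - 1 - x) / eta.

(* quantization outcome: for each (j,i), whether coordinate i of v_j was rounded up *)
Definition qchoice (q d : nat) := {ffun 'I_q * 'I_d -> bool}.

Definition scaled (d : nat) (x : R) : R := Num.sqrt (d%:R / 2) * x.

Definition qprob (eta : R) (q d : nat) (v : 'I_q -> 'I_d -> R) (c : qchoice q d) : R :=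
  \prod_(p : 'I_q * 'I_d) Qprob eta (scaled d (v p.1 p.2)) (c p).

Definition wDQ (eta : R) (q d : nat) (v : 'I_q -> 'I_d -> R) (c : qchoice q d) (i : 'I_d) : R :=
  \sum_(j < q) Qval eta (scaled d (v j i)) (c (j, i)).

Definition expmech (eps : R) (d : nat) (score : 'I_d -> R) (i : 'I_d) : R :=
  expR (eps * score i) / \sum_(j < d) expR (eps * score j).

Definition lap_pdf (eps z : R) : R := eps / 2 * expR (- eps * `|z|).

Definition mw_update (eta : R) (q d m : nat) (P : pt d m -> R) (i : 'I_d) (mu : R) : pt d m -> R :=
  let f := fun x : pt d m => P x * expR (Sval eta (x i) * (mu - wP eta q P i) / (2 * q%:R)) in
  fun x => f x / \sum_(y : pt d m) f y.

Definition h2_error (eta : R) (q d m : nat) (v : 'I_q -> 'I_d -> R) (Pavg : pt d m -> R) : R :=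
  \big[Num.max/0]_(i < d)
     `| q%:R^-1 * wD v i - Num.sqrt (2 / d%:R) * q%:R^-1 * wP eta q Pavg i |.

(* expected error of the remaining k iterations, given the current distribution P,
   the accumulated sum acc = P_1 + ... + P_t, and w(D_Q, .) *)
Fixpoint run_exp (eps eta : R) (q d m T : nat) (v : 'I_q -> 'I_d -> R) (wq : 'I_d -> R)
    (k : nat) (P acc : pt d m -> R) {struct k} : \bar R :=
  match k with
  | 0 => (@h2_error eta q d m v (fun x => acc x / T%:R))%:E
  | k'.+1 =>
      (\sum_(i < d)
        (expmech eps (fun j => `| wP eta q P j - wq j |) i)%:E *
        \int[@lebesgue_measure R]_z
          ((lap_pdf eps z)%:E *
            run_exp eps eta T v wq k' (mw_update eta q P i (wq i + z))
              (fun x => acc x + mw_update eta q P i (wq i + z) x)%R))%E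
  end.

Definition h2_expected_error (eps eta : R) (q d m T : nat) (v : 'I_q -> 'I_d -> R) : \bar R :=
  (\sum_(c : qchoice q d)
     (qprob eta v c)%:E * @run_exp eps eta q d m T v (wDQ eta v c) T (@P0 d m) (fun _ => 0%R))%E.

End H2.

(* Main.v *)
Require Import Defs.
From HB Require Import structures.
From mathcomp Require Import all_boot all_order all_algebra.
From mathcomp Require Import all_classical all_reals all_analysis measurable_realfun.
From mathcomp Require Import ring lra.
Set Implicit Arguments. Unset Strict Implicit. Unset Printing Implicit Defensive.
Import Order.TTheory GRing.Theory Num.Theory.
Import numFieldNormedType.Exports.
Local Open Scope ring_scope.

(* Quantization moves each coordinate of sqrt(d/2) v_j by at most eta, whatever
   the random bits are, so it suffices to compare P_avg with the empirical
   distribution of the quantized points. The potential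
   Phi(P) = -(1/q) sum_j ln P(y_j) over these points y_j is the relative entropy
   up to an additive constant. By Hoeffding's lemma, one update on coordinate i
   with noise z lowers Phi by at least Delta_i^2/3 - (z/q)^2/2, where Delta_i is
   the normalized error of that coordinate. The exponential mechanism picks i
   with E|Delta_i| >= max_j |Delta_j| - ln d/(q eps), and
   |Delta| <= la Delta^2 + 1/(4 la) linearizes the remaining square root, so the
   expected error is bounded by induction on the number of remaining rounds:
   each round only integrates a function of the form al + ga z^2 against the
   Laplace density. The telescoped potential contributes d ln(m+1), with
   m = 2/eta, and 3 ln(m+1) <= 4 ln m for m >= 3 recovers ln(2/eta). For d <= 2
   or eta >= 1 the claim follows from the trivial bound 2 sqrt(2/d). *)

(* No measurability is needed: the integral of a nonnegative function is a
   supremum over the simple functions below it. *)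
Lemma ge0_le_integralT {d} {T : measurableType d} {R : realType}
    (mu : {measure set T -> \bar R}) (f g : T -> \bar R) :
  (forall x, 0 <= f x)%E -> (forall x, f x <= g x)%E ->
  (\int[mu]_x f x <= \int[mu]_x g x)%E.
Proof.
move=> f0 fg.
have g0 x : (0 <= g x)%E by exact: le_trans (f0 x) (fg x).
rewrite !ge0_integralTE//; apply: ge_ereal_sup => _ [h /= hf <-].
by apply: ereal_sup_ubound; exists h => // x; exact: le_trans (hf x) (fg x).
Qed.

(** * Integration against the Laplace density *)

Lemma lap_pdf_ge0 {R : realType} (a z : R) : 0 < a -> 0 <= lap_pdf a z.
Proof. by move=> a0; rewrite mulr_ge0 ?expR_ge0// divr_ge0// ltW. Qed.

Lemma continuous_lap_pdf {R : realType} (a : R) : continuous (lap_pdf a).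
Proof.
move=> x; apply: (@continuousM _ _ (fun=> a / 2) (fun x => expR (- a * `|x|))).
  exact: cst_continuous.
apply: continuous_comp; last exact: continuous_expR.
by apply: continuousM; [exact: cst_continuous|exact: norm_continuous].
Qed.

Lemma integral_lap_pdf {R : realType} (a : R) : 0 < a ->
  (\int[@lebesgue_measure R]_z (lap_pdf a z)%:E = 1)%E.
Proof.
move=> a0; rewrite ge0_symfun_integralT; last 3 first.
- by move=> x; exact: lap_pdf_ge0.
- exact: continuous_lap_pdf.
- by move=> x /=; rewrite /lap_pdf normrN.
(* On the half-line the Laplace density is half the exponential density, whose vanishing on
   negatives extends the integral to the whole line. *)
have -> : (\int[@lebesgue_measure R]_(x in [set x : R | (0 <= x)%R]) (lap_pdf a x)%:E =
   \int[@lebesgue_measure R]_x ((2^-1)%:E * (exponential_pdf a x)%:E))%E.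
  rewrite [LHS]integral_mkcond; apply: eq_integral => x _.
  rewrite patchE; case: ifPn => xs.
    have x0 : 0 <= x by move: xs; rewrite inE.
    by rewrite exponential_pdfE// /lap_pdf ger0_norm// -EFinM mulrA [2^-1 * _]mulrC.
  rewrite lt0_exponential_pdf ?mule0//.
  by rewrite ltNge; apply: contra xs; rewrite inE.
rewrite ge0_integralZl_EFin//.
- by rewrite integral_exponential_pdf// mule1 -EFinM divff.
- by move=> x _; rewrite lee_fin exponential_pdf_ge0// ltW.
- by apply/measurable_EFinP; exact: measurable_exponential_pdf.
Qed.

(* Since z^2 <= (8/a^2) exp(a|z|/2), the exact second moment 2/a^2 need not be
   computed; the lost factor 8 is absorbed by the constant 11 of the theorem. *)
Lemma sqr_lap_pdf_le {R : realType} (a z : R) : 0 < a ->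
  z ^+ 2 * lap_pdf a z <= 16 / a ^+ 2 * lap_pdf (a / 2) z.
Proof.
move=> a0; rewrite /lap_pdf; set u := a * `|z| / 4.
have u0 : 0 <= u by rewrite /u divr_ge0// mulr_ge0// ltW.
(* Of the four factors [expR (- u)], two absorb [u ^+ 2] and the other two form the density of rate
   [a / 2]. *)
have -> : - a * `|z| = - u + (- u + (- u + - u)) by rewrite /u; field.
have -> : - (a / 2) * `|z| = - u + - u by rewrite /u; field.
have za : z ^+ 2 = 16 * u ^+ 2 / a ^+ 2.
  by rewrite /u !exprMn real_normK ?num_real//; field; rewrite gt_eqF.
(* Squaring [expR (u / 2) >= 1 + u / 2] gives [expR u >= (1 + u / 2) ^+ 2 >= 2 * u]. *)
have h : u * expR (- u) <= 2^-1.
  rewrite expRN ler_pdivrMr ?expR_gt0// [in expR u](splitr u) expRD.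
  have := expR_ge1Dx (u / 2); set w := expR _.
  move=> hw; have : (1 + u / 2) ^+ 2 <= w ^+ 2.
    by rewrite ler_sqr ?nnegrE; lra.
  have := sqr_ge0 (1 - u / 2); lra.
rewrite za !expRD; set e := expR (- u).
have e0 : 0 <= e by exact: expR_ge0.
have h2 : (u * e) ^+ 2 <= 4^-1.
  have ue : 0 <= u * e by exact: mulr_ge0.
  rewrite -/e in h; nra.
have -> : 16 * u ^+ 2 / a ^+ 2 * (a / 2 * (e * (e * (e * e)))) =
  8 / a * ((u * e) ^+ 2 * (e * e)) by field; rewrite gt_eqF.
have -> : 16 / a ^+ 2 * (a / 2 / 2 * (e * e)) = 8 / a * (2^-1 * (e * e)).
  by field; rewrite gt_eqF.
rewrite ler_pM2l ?divr_gt0//; nra.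
Qed.

(** The integrand is dominated by a combination of two Laplace densities, of rates [a] and [a / 2],
    each of total mass 1. Only the majorant is measured, so [f] may be the recursively defined
    expected error. *)
Lemma integral_lap_quadratic_le {R : realType} (f : R -> \bar R) (a al ga : R) :
  0 < a -> 0 <= ga -> (forall z, 0 <= f z)%E ->
  (forall z, f z <= (al + ga * z ^+ 2)%:E)%E ->
  (\int[@lebesgue_measure R]_z ((lap_pdf a z)%:E * f z) <=
    (al + 16 * ga / a ^+ 2)%:E)%E.
Proof.
move=> a0 ga0 f0 fle.
have al0 : 0 <= al.
  have := le_trans (f0 0) (fle 0).
  by rewrite expr0n/= mulr0 addr0 lee_fin.
have l0 (b z : R) : 0 < b -> (0 <= (lap_pdf b z)%:E)%E.
  by move=> b0; rewrite lee_fin lap_pdf_ge0.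
have ml b : measurable_fun [set: R] (fun z => (lap_pdf b z)%:E).
  apply/measurable_EFinP; apply: continuous_measurable_fun.
  exact: continuous_lap_pdf.
pose k := 16 * ga / a ^+ 2.
have k0 : 0 <= k by rewrite /k divr_ge0 ?mulr_ge0 ?exprn_ge0// ltW.
apply: (@le_trans _ _ (\int[@lebesgue_measure R]_z
    (al%:E * (lap_pdf a z)%:E + k%:E * (lap_pdf (a / 2) z)%:E))%E).
  apply: ge0_le_integralT => z; first by rewrite mule_ge0// l0.
  apply: (@le_trans _ _ ((lap_pdf a z)%:E * (al + ga * z ^+ 2)%:E)%E).
    by apply: lee_wpmul2l; [exact: l0|exact: fle].
  rewrite -!EFinM -EFinD lee_fin mulrDr [lap_pdf a z * al]mulrC lerD2l.
  have := ler_wpM2l ga0 (@sqr_lap_pdf_le R a z a0).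
  by rewrite /k; congr (_ <= _); ring.
have a20 : 0 < a / 2 by rewrite divr_gt0.
rewrite ge0_integralD//=; last 4 first.
- by move=> z _; rewrite mule_ge0 ?l0 ?lee_fin.
- exact: measurable_funeM (ml a).
- by move=> z _; rewrite mule_ge0 ?l0 ?lee_fin.
- exact: measurable_funeM (ml (a / 2)).
have lapZ b c : 0 < b -> 0 <= c ->
    (\int[@lebesgue_measure R]_z (c%:E * (lap_pdf b z)%:E) = c%:E)%E.
  move=> b0 c0; rewrite ge0_integralZl_EFin ?integral_lap_pdf ?mule1//.
  - by move=> z _; rewrite l0.
  - exact: ml.
by rewrite !lapZ.
Qed.

(** * Hoeffding's lemma on [-1, 1] *)

(** This is [tanh u <= u] cleared of denominators. The difference of the two sides decreases because
    [1 - 2 * x <= expR (- (2 * x))]. *)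
Lemma onem_expR_le {R : realType} (u : R) : 0 <= u ->
  (1 - u) * expR (2 * u) <= 1 + u.
Proof.
move=> u0.
pose f (x : R) := (1 - x) * expR (2 * x) - (1 + x).
pose f' (x : R) := (1 - 2 * x) * expR (2 * x) - 1.
have df (x : R) : is_derive x 1 f (f' x).
  rewrite /f /f'; apply: is_derive_eq.
  by rewrite /GRing.scale/=; ring.
suff : f u <= f 0 by rewrite /f mulr0 expR0 !subr0 mulr1 addr0 subrr subr_le0.
have cf : continuous f.
  by move=> x; apply: differentiable_continuous; apply/derivable1_diffP.
apply: (@ler0_derive1_nincry _ f 0) => //.
- move=> x; rewrite in_itv/= andbT => x0; rewrite derive1E derive_val /f'.
  rewrite subr_le0 -ler_pdivlMr ?expR_gt0// div1r -expRN.
  by rewrite -mulNr; apply: le_trans (expR_ge1Dx _); lra.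
- exact: continuous_subspaceT.
Qed.

(** The case of a variable with values 1 and -1 and mean [b]. The quotient [f] of the two sides
    equals 1 at 0 and is nonincreasing on the nonnegative half-line. *)
Lemma two_point_mgf_le_pos {R : realType} (b t : R) : -1 <= b <= 1 -> 0 <= t ->
  (1 + b) / 2 * expR t + (1 - b) / 2 * expR (- t) <=
  expR (b * t + t ^+ 2 / 2).
Proof.
move=> /andP[b1 b2] t0.
pose w (x : R) := expR (- (b * x) - x ^+ 2 / 2).
pose g (x : R) := (1 + b) / 2 * expR x + (1 - b) / 2 * expR (- x).
pose f x := w x * g x.
pose f' (x : R) := w x * ((- b - x) * g x +
  ((1 + b) / 2 * expR x - (1 - b) / 2 * expR (- x))).
have df (x : R) : is_derive x 1 f (f' x).
  rewrite /f /f' /w /g; apply: is_derive_eq.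
  by rewrite /GRing.scale/=; field.
have cf : continuous f.
  by move=> x; apply: differentiable_continuous; apply/derivable1_diffP.
have : f t <= f 0.
  apply: (@ler0_derive1_nincry _ f 0) => //.
  - move=> x; rewrite in_itv/= andbT => x0; rewrite derive1E derive_val /f'.
    rewrite pmulr_rle0 ?expR_gt0// /g.
    set u := x / 2; have xu : x = u + u by rewrite /u; field.
    have u0 : 0 <= u by rewrite /u divr_ge0// ltW.
    rewrite xu opprD !expRD; set p := expR u; set n := expR (- u).
    have p0 : 0 < p by exact: expR_gt0.
    have n0 : 0 < n by exact: expR_gt0.
    have pn : p * n = 1 by rewrite -expRD subrr expR0.
    have hu : p - n <= u * (p + n).
      have := @onem_expR_le R u u0.
      rewrite (_ : 2 * u = u + u); last by ring.
      rewrite expRD -/p => /(ler_wpM2r (ltW n0)).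
      rewrite (_ : (1 - u) * (p * p) * n = (1 - u) * p * (p * n)); last by ring.
      by rewrite pn; lra.
    (* [p + n = 2 cosh u] and [p - n = 2 sinh u]: the sign of the derivative follows
       from [tanh u <= u] alone. *)
    rewrite -(@pmulr_rle0 _ 2)//.
    rewrite (_ : 2 * _ = - ((1 - b ^+ 2) * ((p + n) * (u * (p + n) - (p - n))) +
       u * (p - n + b * (p + n)) ^+ 2)); last by field.
    rewrite oppr_le0; apply: addr_ge0; last by rewrite mulr_ge0 ?sqr_ge0.
    apply: mulr_ge0; first nra.
    by apply: mulr_ge0; [rewrite addr_ge0 ?ltW|rewrite subr_ge0].
  - exact: continuous_subspaceT.
rewrite /f {2}/w /g mulr0 expr0n/= mul0r oppr0 addr0 expR0 !mulr1 mul1r.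
rewrite (_ : (1 + b) / 2 + (1 - b) / 2 = 1); last by field.
by rewrite /w -opprD [expR (- (_ + _))]expRN ler_pdivrMl ?expR_gt0// mulr1.
Qed.

Lemma two_point_mgf_le {R : realType} (b t : R) : -1 <= b <= 1 ->
  (1 + b) / 2 * expR t + (1 - b) / 2 * expR (- t) <=
  expR (b * t + t ^+ 2 / 2).
Proof.
move=> b1; have [t0|t0] := leP 0 t; first exact: two_point_mgf_le_pos.
have nb : -1 <= - b <= 1 by lra.
have nt : 0 <= - t by rewrite oppr_ge0 ltW.
have := @two_point_mgf_le_pos R _ _ nb nt.
by rewrite !opprK mulrNN sqrrN addrC.
Qed.

(** By convexity each exponential lies below its chord over [-1, 1], and averaging the chords leaves
    the two-point variable with the same mean. *)
Lemma hoeffding_mgf {R : realType} (I : finType) (p s : I -> R) (t : R) :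
  (forall i, 0 <= p i) -> \sum_i p i = 1 -> (forall i, -1 <= s i <= 1) ->
  \sum_i p i * expR (t * s i) <= expR (t * (\sum_i p i * s i) + t ^+ 2 / 2).
Proof.
move=> p0 p1 s1; set b := \sum_i p i * s i.
(* The tangent at [t * s i] is evaluated at [t] and [- t]; with weights [(1 + s i) / 2] and
   [(1 - s i) / 2] the first-order terms cancel. *)
have chord i : expR (t * s i) <=
    (1 + s i) / 2 * expR t + (1 - s i) / 2 * expR (- t).
  have /andP[sl sr] := s1 i.
  set x := t * s i; have e0 := expR_gt0 x.
  have h1 : expR x * (1 + (t - x)) <= expR t.
    by rewrite -{2}(subrKC x t) expRD ler_pM2l// expR_ge1Dx.
  have h2 : expR x * (1 + (- t - x)) <= expR (- t).
    by rewrite -{2}(subrKC x (- t)) expRD ler_pM2l// expR_ge1Dx.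
  have k1 : 0 <= (1 + s i) / 2 by lra.
  have k2 : 0 <= (1 - s i) / 2 by lra.
  have := lerD (ler_wpM2l k1 h1) (ler_wpM2l k2 h2).
  by apply: le_trans; rewrite le_eqVlt; apply/orP; left; apply/eqP; rewrite /x; field.
have b1 : -1 <= b <= 1.
  rewrite -p1 -sumrN; apply/andP; split; apply: ler_sum => i _.
    by have := p0 i; have /andP[] := s1 i; nra.
  by have := p0 i; have /andP[] := s1 i; nra.
rewrite [t * b]mulrC; apply: le_trans (@two_point_mgf_le R b t b1).
apply: (le_trans (ler_sum _ (fun i _ => ler_wpM2l (p0 i) (chord i)))).
rewrite le_eqVlt; apply/orP; left; apply/eqP.
transitivity (\sum_i (p i * ((expR t + expR (- t)) / 2) +
   p i * s i * ((expR t - expR (- t)) / 2))).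
  by apply: eq_bigr => i _; field.
by rewrite big_split/= -!mulr_suml p1 -/b; field.
Qed.

(** * The exponential mechanism *)

Lemma expmech_ge0 {R : realType} (eps : R) d (score : 'I_d -> R) i :
  0 <= expmech eps score i.
Proof. by rewrite divr_ge0 ?expR_ge0// sumr_ge0// => j _; exact: expR_ge0. Qed.

Lemma expmech_norm_gt0 {R : realType} (eps : R) d (score : 'I_d -> R) (i0 : 'I_d) :
  0 < \sum_(j < d) expR (eps * score j).
Proof.
rewrite (bigD1 i0)//= ltr_pwDl ?expR_gt0//.
by rewrite sumr_ge0// => j _; exact: expR_ge0.
Qed.

Lemma sum_expmech {R : realType} (eps : R) d (score : 'I_d -> R) (i0 : 'I_d) :
  \sum_i expmech eps score i = 1.
Proof. by rewrite -mulr_suml divff// gt_eqF// expmech_norm_gt0. Qed.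

(** Gibbs variational principle: [ln Z] is [eps] times the mean score plus the entropy of [p], and
    the entropy is at most [ln d%:R], while [ln Z] dominates every [eps * score j]. The entropy
    bound is obtained by summing [tangent]. *)
Lemma expmech_utility {R : realType} (eps : R) d (score : 'I_d -> R) j :
  0 < eps ->
  score j <= \sum_i expmech eps score i * score i + ln d%:R / eps.
Proof.
move=> eps0; set p := expmech eps score.
pose Z := \sum_(i < d) expR (eps * score i).
have Z0 : 0 < Z by exact: expmech_norm_gt0.
have d0 : 0 < d%:R :> R by rewrite ltr0n; case: (d) j => // -[].
have ZE : expR (ln Z) = Z by rewrite lnK.
have dE : expR (ln d%:R) = d%:R :> R by rewrite lnK.
have p1 : \sum_i p i = 1 by exact: sum_expmech.
have tangent i : p i * (1 + (ln Z - ln d%:R)) - eps * (p i * score i) <= d%:R^-1.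
  have -> : d%:R^-1 = p i * expR (ln Z - ln d%:R - eps * score i).
    rewrite !expRD expRN dE ZE expRN /p /expmech -/Z.
    by field; rewrite !gt_eqF ?expR_gt0.
  have := ler_wpM2l (expmech_ge0 eps score i)
    (expR_ge1Dx (ln Z - ln d%:R - eps * score i)).
  by apply: le_trans; rewrite -/p le_eqVlt; apply/orP; left; apply/eqP; ring.
have lnZ : eps * score j <= ln Z.
  by rewrite -ler_expR ZE /Z (bigD1 j)//= lerDl sumr_ge0.
have := ler_sum (index_enum _) (P := xpredT) (fun i _ => tangent i).
rewrite sumrB -mulr_suml p1 -mulr_sumr sumr_const card_ord -(mulr_natr d%:R^-1).
rewrite mulVf ?gt_eqF// => h.
rewrite -(ler_pM2l eps0) mulrDr [eps * (_ / _)]mulrC divfK ?gt_eqF//.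
by move: h lnZ; rewrite -/p; lra.
Qed.

(** * Grid means and multiplicative weights updates *)

Lemma wPE {R : realType} (eta : R) q d m (P : pt d m -> R) i :
  wP eta q P i = q%:R * \sum_x P x * Sval eta (x i).
Proof.
congr (_ * _); rewrite (partition_big (fun x : pt d m => x i) xpredT)//=.
apply: eq_bigr => s _; rewrite /marg mulr_sumr.
by apply: eq_bigr => x /eqP->; rewrite mulrC.
Qed.

Lemma wPD {R : realType} (eta : R) q d m (P Q : pt d m -> R) i :
  wP eta q (fun x => P x + Q x) i = wP eta q P i + wP eta q Q i.
Proof.
rewrite !wPE -mulrDr -big_split/=; congr (_ * _).
by apply: eq_bigr => x _; rewrite mulrDl.
Qed.

Lemma wPZ {R : realType} (eta : R) q d m (P : pt d m -> R) c i :
  wP eta q (fun x => P x * c) i = wP eta q P i * c.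
Proof.
rewrite !wPE -mulrA mulr_suml; congr (_ * _).
by apply: eq_bigr => x _; rewrite mulrAC.
Qed.

Lemma Sval_bound {R : realType} (eta : R) m (k : 'I_m.+1) :
  0 < eta -> m%:R * eta = 2 -> -1 <= Sval eta k <= 1.
Proof.
move=> eta0 meta; rewrite /Sval lerDl mulr_ge0 ?(ltW eta0)//=.
have : k%:R * eta <= m%:R * eta by rewrite ler_pM2r// ler_nat -ltnS.
by rewrite meta; lra.
Qed.

(** Strict positivity makes every [ln (P x)] in the potential a genuine logarithm; the updates
    preserve it. *)
Definition positive_dist {R : realType} {I : finType} (P : I -> R) : Prop :=
  (forall x, 0 < P x) /\ \sum_x P x = 1.

Lemma positive_dist_le1 {R : realType} {I : finType} (P : I -> R) x :
  positive_dist P -> P x <= 1.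
Proof.
move=> [P0 <-]; rewrite (bigD1 x)//= lerDl sumr_ge0// => y _.
exact: ltW.
Qed.

Lemma positive_dist_P0 {R : realType} d m : positive_dist (@P0 R d m).
Proof.
have c0 : 0 < #|{: pt d m}|%:R :> R.
  by rewrite ltr0n; apply/card_gt0P; exists [ffun=> ord0].
split => [x|]; first by rewrite invr_gt0.
by rewrite sumr_const -[_ *+ _]mulr_natr mulVf// gt_eqF.
Qed.

Lemma wP_dist_bound {R : realType} (eta : R) q d m (P : pt d m -> R) i :
  0 < eta -> m%:R * eta = 2 -> positive_dist P -> `|wP eta q P i| <= q%:R.
Proof.
move=> eta0 meta [P0 P1]; rewrite wPE normrM ger0_norm// -{2}[q%:R]mulr1.
rewrite ler_wpM2l// (le_trans (ler_norm_sum _ _ _))// -P1.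
apply: ler_sum => x _; rewrite normrM gtr0_norm// ler_piMr//; first exact: ltW.
by rewrite ler_norml; exact: Sval_bound.
Qed.

Section mw_update_dist.
Context {R : realType}.
Variables (eta : R) (q d m : nat) (P : pt d m -> R) (i : 'I_d) (mu : R).
Hypothesis distP : positive_dist P.
Let theta := (mu - wP eta q P i) / (2 * q%:R).

Lemma mw_update_norm_gt0 : 0 < \sum_x P x * expR (theta * Sval eta (x i)).
Proof.
have [P0 _] := distP.
rewrite (bigD1 [ffun=> ord0])//= ltr_pwDl ?mulr_gt0 ?expR_gt0//.
by rewrite sumr_ge0// => y _; rewrite ltW// mulr_gt0 ?expR_gt0.
Qed.

(** In this form the normalizer is the moment generating function bounded by [hoeffding_mgf]. *)
Lemma mw_updateE x : mw_update eta q P i mu x =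
  P x * expR (theta * Sval eta (x i)) /
  \sum_y P y * expR (theta * Sval eta (y i)).
Proof.
have E y : P y * expR (Sval eta (y i) * (mu - wP eta q P i) / (2 * q%:R)) =
    P y * expR (theta * Sval eta (y i)).
  by congr (_ * expR _); rewrite /theta -mulrA mulrC.
by rewrite /mw_update E; congr (_ / _); apply: eq_bigr => y _.
Qed.

Lemma positive_dist_mw_update : positive_dist (mw_update eta q P i mu).
Proof.
have Z0 := mw_update_norm_gt0; have [P0 _] := distP; split => [x|].
  by rewrite mw_updateE divr_gt0// mulr_gt0 ?expR_gt0.
under eq_bigr do rewrite mw_updateE.
by rewrite -mulr_suml divff// gt_eqF.
Qed.

End mw_update_dist.

(** * The potential and its decrease *)

Definition potential {R : realType} {q : nat} {I : finType} (y : 'I_q -> I)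
  (P : I -> R) : R := q%:R^-1 * \sum_(j < q) - ln (P (y j)).

Lemma potential_ge0 {R : realType} {q : nat} {I : finType} (y : 'I_q -> I)
  (P : I -> R) : positive_dist P -> 0 <= potential y P.
Proof.
move=> dP; rewrite mulr_ge0 ?invr_ge0// sumr_ge0// => j _.
by rewrite oppr_ge0 ln_le0// positive_dist_le1.
Qed.

Lemma potential_P0 {R : realType} q d m (y : 'I_q -> pt d m) : (0 < q)%N ->
  potential y (@P0 R d m) = d%:R * ln m.+1%:R.
Proof.
move=> q0; rewrite /potential /P0 sumr_const card_ord.
rewrite card_ffun !card_ord lnV ?posrE ?ltr0n ?expn_gt0// opprK natrX lnXn ?ltr0n//.
by rewrite -(mulr_natl (_ *+ d)) mulKf ?pnatr_eq0 -?lt0n// mulr_natl.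
Qed.

Lemma potential_mw_update {R : realType} (eta : R) q d m (y : 'I_q -> pt d m)
    (P : pt d m -> R) (i : 'I_d) (z : R) (w := \sum_(j < q) Sval eta (y j i)) :
  (0 < q)%N -> 0 < eta -> m%:R * eta = 2 -> positive_dist P ->
  potential y (mw_update eta q P i (w + z)) <=
  potential y P - ((wP eta q P i - w) / q%:R) ^+ 2 / 3 + (z / q%:R) ^+ 2 / 2.
Proof.
move=> q0 eta0 meta dP; have [P0 P1] := dP.
have q0' : q%:R != 0 :> R by rewrite pnatr_eq0 -lt0n.
set theta := (w + z - wP eta q P i) / (2 * q%:R).
set Z := \sum_x P x * expR (theta * Sval eta (x i)).
have Z0 : 0 < Z by exact: mw_update_norm_gt0.
have lnZ : ln Z <= theta * (wP eta q P i / q%:R) + theta ^+ 2 / 2.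
  rewrite -ler_expR lnK ?posrE// wPE [q%:R * _]mulrC mulfK//.
  apply: hoeffding_mgf => // x; first exact: ltW.
  exact: Sval_bound.
have -> : potential y (mw_update eta q P i (w + z)) =
    potential y P - theta * (w / q%:R) + ln Z.
  rewrite /potential.
  have -> : \sum_(j < q) - ln (mw_update eta q P i (w + z) (y j)) =
      \sum_(j < q) - ln (P (y j)) - theta * w + q%:R * ln Z.
    rewrite /w mulr_sumr -sumrN -big_split/= -[q in q%:R * _]card_ord.
    rewrite mulr_natl -sumr_const -big_split/=; apply: eq_bigr => j _.
    rewrite mw_updateE -/theta -/Z ln_div ?posrE ?mulr_gt0 ?expR_gt0//.
    by rewrite lnM ?posrE ?expR_gt0// expRK; ring.
  by field.
set D := (wP eta q P i - w) / q%:R; set ze := z / q%:R.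
have thetaE : theta = (ze - D) / 2 by rewrite /theta /ze /D; field.
have bE : wP eta q P i / q%:R = w / q%:R + D by rewrite /D; field.
rewrite bE in lnZ.
(* The change is at most [theta * D + theta ^+ 2 / 2], that is [- 3 / 8 * D ^+ 2 + D * ze / 4 + ze
   ^+ 2 / 8]. It falls short of the claimed bound by exactly [(D - 3 * ze) ^+ 2 / 24]. *)
have := sqr_ge0 (D - 3 * ze); rewrite thetaE in lnZ *; move: lnZ; lra.
Qed.

(** * Randomized rounding to the grid *)

Lemma Qprob_sum {R : realType} (eta x : R) : eta != 0 ->
  Qprob eta x true + Qprob eta x false = 1.
Proof. by move=> eta0; rewrite /Qprob; field. Qed.

Lemma qk_itv {R : realType} (eta x : R) : 0 < eta ->
  qk eta x * eta <= x + 1 < (qk eta x + 1) * eta.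
Proof.
move=> eta0; rewrite /qk -ler_pdivlMr// -ltr_pdivrMr//.
have := real_floor_itv (num_real ((x + 1) / eta)).
by rewrite intrD.
Qed.

Lemma Qprob_ge0 {R : realType} (eta x : R) b : 0 < eta -> 0 <= Qprob eta x b.
Proof.
move=> eta0; have /andP[h1 h2] := qk_itv x eta0.
by rewrite /Qprob; case: b; rewrite divr_ge0 ?(ltW eta0)//; lra.
Qed.

Lemma Qval_dist {R : realType} (eta x : R) b : 0 < eta ->
  `|Qval eta x b - x| <= eta.
Proof.
move=> eta0; have /andP[h1 h2] := qk_itv x eta0.
by rewrite ler_norml /Qval; case: b; apply/andP; split; lra.
Qed.

(** At [x = 1] the floor is already [m], and rounding up would leave the grid; that outcome has
    probability 0 and is excluded by the last hypothesis. *)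
Lemma Qval_grid {R : realType} (eta x : R) m b : 0 < eta -> m%:R * eta = 2 ->
  `|x| <= 1 -> Qprob eta x b != 0 ->
  exists k : 'I_m.+1, Qval eta x b = Sval eta k.
Proof.
move=> eta0 meta; rewrite ler_norml => /andP[xl xr] p0.
have /andP[h1 h2] := qk_itv x eta0.
have fl0 : 0 <= Num.floor ((x + 1) / eta).
  by rewrite floor_ge0 divr_ge0 ?(ltW eta0)//; lra.
pose k := `|Num.floor ((x + 1) / eta)|%N.
have kE : qk eta x = k%:R by rewrite /qk /k natr_absz ger0_norm.
rewrite kE in h1 h2.
have km : (k <= m)%N.
  rewrite -(ler_nat R) -(ler_pM2r eta0) meta; lra.
case: b p0 => [p0|_]; last first.
  by exists (Ordinal (n := m.+1) (m := k) km); rewrite /Qval kE /Sval.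
have km' : (k < m)%N.
  rewrite ltn_neqAle km andbT; apply: contra p0 => /eqP km'.
  have := kE; rewrite km' /Qprob => ->.
  rewrite km' in h1; rewrite meta.
  by rewrite (_ : x + 1 - 2 = 0) ?mul0r//; lra.
exists (Ordinal (n := m.+1) (m := k.+1) km').
by rewrite /Qval kE /Sval/= -natr1.
Qed.

Lemma qprob_ge0 {R : realType} (eta : R) q d v (c : qchoice q d) : 0 < eta ->
  0 <= qprob eta v c.
Proof. by move=> eta0; apply: prodr_ge0 => p _; exact: Qprob_ge0. Qed.

Lemma sum_qprob {R : realType} (eta : R) q d (v : 'I_q -> 'I_d -> R) :
  0 < eta -> \sum_(c : qchoice q d) qprob eta v c = 1.
Proof.
move=> eta0; rewrite /qprob.
rewrite -(bigA_distr_bigA (fun p b => Qprob eta (scaled d (v p.1 p.2)) b))/=.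
by apply: big1 => p _; rewrite big_bool/= Qprob_sum ?gt_eqF.
Qed.

Lemma sqrt_scaled {R : realType} d (x : R) : (0 < d)%N ->
  Num.sqrt (2 / d%:R) * scaled d x = x.
Proof.
move=> d0; have d0' : 0 < d%:R :> R by rewrite ltr0n.
rewrite /scaled mulrA -sqrtrM ?divr_ge0//.
have -> : 2 / d%:R * (d%:R / 2) = 1 :> R by field; rewrite gt_eqF.
by rewrite sqrtr1 mul1r.
Qed.

Lemma scaled_le1 {R : realType} d (x : R) : (0 < d)%N ->
  `|x| <= Num.sqrt (2 / d%:R) -> `|scaled d x| <= 1.
Proof.
move=> d0; rewrite -{1}(sqrt_scaled x d0) normrM ger0_norm ?sqrtr_ge0//.
by rewrite ger_pMr ?sqrtr_gt0 ?divr_gt0 ?ltr0n.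
Qed.

Lemma wD_wDQ_dist {R : realType} (eta : R) q d (v : 'I_q -> 'I_d -> R) c i :
  (0 < d)%N -> 0 < eta ->
  `|wD v i - Num.sqrt (2 / d%:R) * wDQ eta v c i| <=
    q%:R * (Num.sqrt (2 / d%:R) * eta).
Proof.
move=> d0 eta0; set K := Num.sqrt _.
rewrite /wD /wDQ mulr_sumr -sumrB.
apply: le_trans (ler_norm_sum _ _ _) _.
rewrite -[q in q%:R]card_ord mulr_natl -sumr_const; apply: ler_sum => j _.
rewrite -{1}(sqrt_scaled (v j i) d0) -/K -mulrBr normrM ger0_norm ?sqrtr_ge0//.
by rewrite ler_wpM2l ?sqrtr_ge0// distrC Qval_dist.
Qed.

(** Supplies the quantized points [y j], as elements of the index grid, on which the potential is
    built. *)
Lemma wDQ_grid {R : realType} (eta : R) q d m (v : 'I_q -> 'I_d -> R)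
    (c : qchoice q d) :
  (0 < d)%N -> 0 < eta -> m%:R * eta = 2 ->
  (forall j i, `|v j i| <= Num.sqrt (2 / d%:R)) -> qprob eta v c != 0 ->
  exists y : 'I_q -> pt d m,
    forall i, wDQ eta v c i = \sum_(j < q) Sval eta (y j i).
Proof.
move=> d0 eta0 meta hv /prodf_neq0 pc.
have H (p : 'I_q * 'I_d) : exists k : 'I_m.+1,
    Qval eta (scaled d (v p.1 p.2)) (c p) == Sval eta k.
  have [k ->] := Qval_grid eta0 meta (scaled_le1 d0 (hv p.1 p.2)) (pc p isT).
  by exists k.
exists (fun j => [ffun i => xchoose (H (j, i))]) => i.
by apply: eq_bigr => j _; rewrite ffunE -(eqP (xchooseP (H (j, i)))).
Qed.

(** * Expected error of the remaining rounds *)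

Section run_exp_bounds.
Context {R : realType}.
Variables (eps eta : R) (q d m T : nat) (v : 'I_q -> 'I_d -> R) (wq : 'I_d -> R).
Hypothesis eps0 : 0 < eps.

Let next (P : pt d m -> R) i z := mw_update eta q P i (wq i + z).

Lemma run_exp_ge0 k (P acc : pt d m -> R) :
  (0 <= run_exp eps eta T v wq k P acc)%E.
Proof.
elim: k P acc => [|k IH] P acc /=.
  by rewrite lee_fin; apply: bigmax_ge_id.
apply: sume_ge0 => i _; apply: mule_ge0; first by rewrite lee_fin expmech_ge0.
by apply: integral_ge0 => z _; rewrite mule_ge0// lee_fin lap_pdf_ge0.
Qed.

(** The induction step shared by both error bounds. The noise coefficient [ga] is uniform in [i], so
    only [al] is averaged by the mechanism. *)
Lemma run_expS_le k (P acc : pt d m -> R) (al : 'I_d -> R) (ga B : R) :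
  (0 < d)%N -> 0 <= ga ->
  (forall i z, run_exp eps eta T v wq k (next P i z)
     (fun x => (acc x + next P i z x)%R) <= (al i + ga * z ^+ 2)%:E)%E ->
  \sum_i expmech eps (fun j => `|wP eta q P j - wq j|) i * al i
    + 16 * ga / eps ^+ 2 <= B ->
  (run_exp eps eta T v wq k.+1 P acc <= B%:E)%E.
Proof.
move=> d0 ga0 step leB /=; set p := expmech _ _.
apply: (@le_trans _ _ (\sum_(i < d) (p i * (al i + 16 * ga / eps ^+ 2))%:E)%E).
  apply: lee_sum => i _; rewrite (EFinM (p i)); apply: lee_wpmul2l.
    by rewrite lee_fin expmech_ge0.
  by apply: integral_lap_quadratic_le => // z; [exact: run_exp_ge0|exact: step].
rewrite sumEFin lee_fin; apply: le_trans leB.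
under eq_bigr do rewrite mulrDr.
by rewrite big_split/= -mulr_suml (sum_expmech _ _ (Ordinal d0)) mul1r.
Qed.

Hypotheses (q0 : (0 < q)%N) (d0 : (0 < d)%N) (T0 : (0 < T)%N) (eta0 : 0 < eta).
Hypothesis meta : m%:R * eta = 2.
Let K : R := Num.sqrt (2 / d%:R).

Let q0' : 0 < q%:R :> R. Proof. by rewrite ltr0n. Qed.
Let T0' : 0 < T%:R :> R. Proof. by rewrite ltr0n. Qed.

Lemma h2_error_avg_le (acc : pt d m -> R) (B : R) : 0 <= B ->
  (forall i, `|T%:R * wD v i - K * wP eta q acc i| <= T%:R * q%:R * B) ->
  h2_error eta v (fun x => acc x / T%:R) <= B.
Proof.
move=> B0 hB; apply: bigmax_le => // i _.
rewrite -/K wPZ (_ : _ - _ = (T%:R * q%:R)^-1 * (T%:R * wD v i - K * wP eta q acc i)).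
  rewrite normrM gtr0_norm ?invr_gt0 ?mulr_gt0// ler_pdivrMl ?mulr_gt0//.
by field; rewrite !gt_eqF.
Qed.

Lemma run_exp_le_trivial k N (P acc : pt d m -> R) :
  (N + k)%N = T -> positive_dist P ->
  (forall j i, `|v j i| <= K) ->
  (forall i, `|wP eta q acc i| <= N%:R * q%:R) ->
  (run_exp eps eta T v wq k P acc <= (2 * K)%:E)%E.
Proof.
move=> + + hv; have K0 : 0 <= K by exact: sqrtr_ge0.
elim: k N P acc => [|k IH] N P acc NT dP accN.
  rewrite addn0 in NT; rewrite lee_fin; apply: h2_error_avg_le => [|i].
    by rewrite mulr_ge0.
  rewrite (le_trans (ler_normB _ _))// [`|T%:R * _|]normrM [`|K * _|]normrM.
  rewrite (ger0_norm K0) (ger0_norm (ltW T0')).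
  have wDle : `|wD v i| <= q%:R * K.
    apply: le_trans (ler_norm_sum _ _ _) _.
    rewrite -[q in q%:R]card_ord mulr_natl -sumr_const.
    by apply: ler_sum => j _; exact: hv.
  have := accN i; rewrite NT => /(ler_wpM2l K0).
  have := ler_wpM2l (ltW T0') wDle; lra.
apply: (@run_expS_le _ _ _ (fun=> 2 * K) 0) => //; last first.
  by rewrite -mulr_suml (sum_expmech _ _ (Ordinal d0)); lra.
move=> i z; rewrite mul0r addr0; apply: (IH N.+1).
- by rewrite addSnnS.
- exact: positive_dist_mw_update.
- move=> j; rewrite wPD (le_trans (ler_normD _ _))// -natr1 mulrDl mul1r.
  by rewrite lerD// wP_dist_bound//; exact: positive_dist_mw_update.
Qed.

(* [c] is the number of rounds summed up in [Q]: 1 for a single iterate, [N] for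
   the accumulator after [N] rounds. *)
Definition maxdev (c : R) (Q : pt d m -> R) : R :=
  \big[Num.max/0]_(i < d) (`|wP eta q Q i - c * wq i| / q%:R).

Lemma maxdev_ge0 c Q : 0 <= maxdev c Q.
Proof. exact: bigmax_ge_id. Qed.

Lemma maxdev_ge c Q i : `|wP eta q Q i - c * wq i| / q%:R <= maxdev c Q.
Proof. exact: (le_bigmax _ (fun i => `|wP eta q Q i - c * wq i| / q%:R)). Qed.

Lemma maxdevD c c' Q Q' :
  maxdev (c + c') (fun x => Q x + Q' x) <= maxdev c Q + maxdev c' Q'.
Proof.
apply: bigmax_le => [|i _]; first by rewrite addr_ge0 ?maxdev_ge0.
apply: le_trans (lerD (maxdev_ge c Q i) (maxdev_ge c' Q' i)).
rewrite -mulrDl ler_pM2r ?invr_gt0// wPD mulrDl opprD addrACA.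
exact: ler_normD.
Qed.

Variable y : 'I_q -> pt d m.
Hypothesis wqE : forall i, wq i = \sum_(j < q) Sval eta (y j i).
Hypothesis wDwq : forall i, `|wD v i - K * wq i| <= q%:R * (K * eta).

Lemma maxdev_le2 P : positive_dist P -> maxdev 1 P <= 2.
Proof.
move=> dP; apply: bigmax_le => // i _; rewrite ler_pdivrMr//.
rewrite mul1r (le_trans (ler_normB _ _))//.
have wqle : `|wq i| <= q%:R.
  rewrite wqE (le_trans (ler_norm_sum _ _ _))//.
  rewrite -[leRHS]mulr1 -[q in q%:R]card_ord mulr_natl -sumr_const.
  by apply: ler_sum => j _; rewrite ler_norml; exact: Sval_bound.
have := wP_dist_bound q i eta0 meta dP; lra.
Qed.

(** The squared deviations are averaged with the same weights [p] that select the updated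
    coordinate, so this term can be cancelled by the expected drop of the potential. *)
Lemma maxdev_le_expmech (la : R) P : 0 < la ->
  maxdev 1 P <= la * (\sum_i expmech eps (fun j => `|wP eta q P j - wq j|) i
      * ((wP eta q P i - wq i) / q%:R) ^+ 2)
    + (4 * la)^-1 + ln d%:R / (q%:R * eps).
Proof.
move=> la0; set p := expmech _ _.
have p0 i : 0 <= p i by exact: expmech_ge0.
have p1 : \sum_i p i = 1 by rewrite (sum_expmech _ _ (Ordinal d0)).
have bnd : \sum_i p i * `|wP eta q P i - wq i| <=
    q%:R * (la * (\sum_i p i * ((wP eta q P i - wq i) / q%:R) ^+ 2) + (4 * la)^-1).
  have -> : (4 * la)^-1 = \sum_i p i * (4 * la)^-1 by rewrite -mulr_suml p1 mul1r.
  rewrite mulr_sumr -big_split/= mulr_sumr.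
  apply: ler_sum => i _.
  set D := (wP eta q P i - wq i) / q%:R.
  have -> : `|wP eta q P i - wq i| = q%:R * `|D|.
    by rewrite /D normrM normfV (gtr0_norm q0') mulrC divfK// gt_eqF.
  rewrite mulrCA ler_pM2l// mulrCA -mulrDr ler_wpM2l// -(real_normK (num_real D)).
  rewrite -subr_ge0 (_ : _ - _ = (2 * la * `|D| - 1) ^+ 2 / (4 * la)).
    by rewrite divr_ge0 ?sqr_ge0// mulr_ge0// ltW.
  by field; rewrite gt_eqF.
apply: bigmax_le => [|i _]; rewrite ?mul1r.
  rewrite addr_ge0// ?divr_ge0 ?mulr_ge0 ?ln_ge0 ?ler1n ?(ltW eps0)//.
  rewrite addr_ge0 ?invr_ge0 ?mulr_ge0 ?(ltW la0)// sumr_ge0// => j _.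
  by rewrite mulr_ge0 ?sqr_ge0.
have := expmech_utility (fun j => `|wP eta q P j - wq j|) i eps0.
rewrite -/p ler_pdivrMr// mulrDl [_ / (_ * _) * _](_ : _ = ln d%:R / eps).
  by move: bnd; rewrite [q%:R * _]mulrC; lra.
by field; rewrite !gt_eqF.
Qed.

(* P_avg averages P_1, ..., P_T while the mechanism scores P_0, ..., P_(T-1); the
   term [2 - maxdev 1 P] accounts for this shift by one round. *)
Lemma run_exp_le_potential (la : R) k N (P acc : pt d m -> R) : 0 < la ->
  (N + k)%N = T -> positive_dist P ->
  (run_exp eps eta T v wq k P acc <= (K * (eta + T%:R^-1 * (maxdev N%:R acc
    + k%:R * ((4 * la)^-1 + ln d%:R / (q%:R * eps) + 24 * la / (q%:R * eps) ^+ 2)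
    + 3 * la * potential y P + 2 - maxdev 1 P)))%:E)%E.
Proof.
move=> la0; have K0 : 0 <= K by exact: sqrtr_ge0.
have Ti0 : 0 <= T%:R^-1 :> R by rewrite invr_ge0.
have la3 : 0 <= 3 * la by rewrite mulr_ge0// ltW.
set C := (4 * la)^-1 + _ + _.
(* With no round left, [maxdev_le2] and [potential_ge0] show that the extra terms are
   nonnegative. *)
elim: k N P acc => [|k IH] N P acc NT dP.
  rewrite addn0 in NT; rewrite lee_fin mul0r addr0 NT; set S := _ - maxdev 1 P.
  have hS : maxdev T%:R acc <= S.
    have := maxdev_le2 dP; have := mulr_ge0 la3 (potential_ge0 y dP).
    by rewrite /S; lra.
  apply: h2_error_avg_le => [|i].
    rewrite mulr_ge0// addr_ge0 ?(ltW eta0)// mulr_ge0//.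
    by apply: le_trans hS; exact: maxdev_ge0.
  rewrite (_ : _ - _ = T%:R * (wD v i - K * wq i) -
    K * (wP eta q acc i - T%:R * wq i)); last by ring.
  apply: le_trans (ler_normB _ _) _.
  rewrite [`|T%:R * _|]normrM [`|K * _|]normrM (ger0_norm K0) (gtr0_norm T0').
  rewrite [leRHS](_ : _ = T%:R * (q%:R * (K * eta)) + K * (q%:R * S)); last first.
    by field; rewrite gt_eqF.
  apply: lerD; apply: ler_wpM2l => //.
  rewrite [q%:R * S]mulrC -ler_pdivrMr//; apply: le_trans hS; exact: maxdev_ge.
(* The factor [3 * la] turns the drop [D ^+ 2 / 3] into [la * D ^+ 2], and the noise term
   [(z / q%:R) ^+ 2 / 2] into [ga]; then [16 * ga / eps ^+ 2] yields the constant 24 = 16 * 3 /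
   2. *)
pose al i := K * (eta + T%:R^-1 * (maxdev N%:R acc + k%:R * C
   + 3 * la * (potential y P - ((wP eta q P i - wq i) / q%:R) ^+ 2 / 3) + 2)).
pose ga := K * T%:R^-1 * (3 * la / (2 * q%:R ^+ 2)).
apply: (@run_expS_le _ _ _ al ga) => //.
- by rewrite /ga mulr_ge0 ?divr_ge0 ?mulr_ge0 ?exprn_ge0 ?(ltW la0).
- move=> i z; apply: le_trans (IH N.+1 _ _ _ _) _.
  + by rewrite addSnnS.
  + exact: positive_dist_mw_update.
  + have pot := potential_mw_update y i z q0 eta0 meta dP.
    rewrite -wqE in pot; move: pot => /(ler_wpM2l la3) pot.
    rewrite lee_fin [leRHS](_ : _ = K * (eta + T%:R^-1 * (maxdev N%:R acc + k%:R * C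
      + 3 * la * (potential y P - ((wP eta q P i - wq i) / q%:R) ^+ 2 / 3
      + (z / q%:R) ^+ 2 / 2) + 2))); last first.
      by rewrite /al /ga; field; rewrite !gt_eqF.
    rewrite ler_wpM2l// lerD2l ler_wpM2l//.
    (* Adding the new iterate costs at most its own [maxdev 1], which the induction hypothesis
       subtracts. *)
    have := maxdevD N%:R 1 acc (next P i z); rewrite natr1 -/(next P i z).
    by move: pot; rewrite -/(next P i z); lra.
- set p := expmech _ _.
  have p1 : \sum_i p i = 1 by rewrite (sum_expmech _ _ (Ordinal d0)).
  set S2 := \sum_i p i * ((wP eta q P i - wq i) / q%:R) ^+ 2.
  have hE : maxdev 1 P <= la * S2 + (4 * la)^-1 + ln d%:R / (q%:R * eps).
    exact: maxdev_le_expmech.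
  clearbody p.
  have -> : \sum_i p i * al i = K * (eta + T%:R^-1 * (maxdev N%:R acc + k%:R * C
      + 3 * la * potential y P + 2 - la * S2)).
    transitivity (\sum_i (p i * (K * (eta + T%:R^-1 * (maxdev N%:R acc + k%:R * C
      + 3 * la * potential y P + 2))) -
      p i * ((wP eta q P i - wq i) / q%:R) ^+ 2 * (K * T%:R^-1 * la))).
      by apply: eq_bigr => i _; rewrite /al; field; rewrite !gt_eqF.
    by rewrite sumrB -!mulr_suml p1 -/S2; ring.
  (* Now [hE] trades [- la * S2] for [- maxdev 1 P] plus two of the three terms of [C]; the noise
     supplies the third. *)
  rewrite [leLHS](_ : _ = K * (eta + T%:R^-1 * (maxdev N%:R acc + k%:R * C
      + 3 * la * potential y P + 2 - la * S2 + 24 * la / (q%:R * eps) ^+ 2))).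
    rewrite ler_wpM2l// lerD2l ler_wpM2l// -natr1 mulrDl mul1r /C.
    by lra.
  by rewrite /ga; field; rewrite !gt_eqF.
Qed.

End run_exp_bounds.

(** * Averaging over the quantization and numerical estimates *)

Lemma h2_expected_error_le {R : realType} (eps eta B : R) (q d m T : nat)
    (v : 'I_q -> 'I_d -> R) : 0 < eta ->
  (forall c, qprob eta v c != 0%R ->
    run_exp eps eta T v (wDQ eta v c) T (@P0 R d m) (fun=> 0%R) <= B%:E)%E ->
  (h2_expected_error eps eta m T v <= B%:E)%E.
Proof.
move=> eta0 leB; rewrite /h2_expected_error.
apply: (@le_trans _ _ (\sum_(c : qchoice q d) (qprob eta v c * B)%:E)%E).
  apply: lee_sum => c _; rewrite (EFinM (qprob eta v c)).
  have [->|c0] := eqVneq (qprob eta v c) 0; first by rewrite !mul0e.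
  by apply: lee_wpmul2l; [rewrite lee_fin qprob_ge0|exact: leB].
by rewrite sumEFin -mulr_suml sum_qprob// mul1r.
Qed.

Lemma wP0 {R : realType} (eta : R) q d m i : wP eta q (fun _ : pt d m => 0) i = 0.
Proof. by rewrite wPE big1 ?mulr0// => x _; rewrite mul0r. Qed.

Lemma half_le_ln {R : realType} (d : nat) : (2 <= d)%N -> 2^-1 <= ln d%:R :> R.
Proof.
move=> d2; have d0 : 0 < d%:R :> R by rewrite ltr0n (leq_trans _ d2).
rewrite -ler_expR lnK ?posrE//; apply: (@le_trans _ _ 2); last by rewrite ler_nat.
have := ler_wpM2l (expR_ge0 2^-1) (expR_ge1Dx (- 2^-1 : R)).
by rewrite -expRD subrr expR0; lra.
Qed.

(** Amounts to [(m + 1) ^ 3 <= m ^ 4], which holds from 3 on and fails at 2. The difference is [x ^+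
    3 * (x - 3) + 2 * x ^+ 2 * (x - 3) + 3 * x * (x - 3) + 6 * x - 1]. *)
Lemma ln_succ_le {R : realType} (m : nat) : (3 <= m)%N ->
  3 * ln m.+1%:R <= 4 * ln m%:R :> R.
Proof.
move=> m3; have m0 : 0 < m%:R :> R by rewrite ltr0n (leq_trans _ m3).
rewrite !mulr_natl -!lnXn ?ltr0n//; last by rewrite (leq_trans _ m3).
rewrite ler_ln ?posrE ?exprn_gt0 ?ltr0n ?(leq_trans _ m3)//.
rewrite -natr1; have : 3 <= m%:R :> R by rewrite ler_nat.
set x := m%:R => x3.
have h1 : 0 <= x ^+ 3 * (x - 3) by rewrite mulr_ge0 ?subr_ge0// exprn_ge0// ltW.
have h2 : 0 <= x ^+ 2 * (x - 3) by rewrite mulr_ge0 ?subr_ge0// exprn_ge0// ltW.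
have h3 : 0 <= x * (x - 3) by rewrite mulr_ge0 ?subr_ge0// ltW.
nra.
Qed.

(** As [4 / D = 2 * K ^+ 2], either [K >= 1] and [K <= K ^+ 2], or [eta >= 1] and
    [2 * K <= 2 * K ^+ 2 + 1]. *)
Lemma trivial_error_bound {R : realType} (D eta : R) : 0 < D -> 0 < eta ->
  D <= 2 \/ 1 <= eta -> 2 * Num.sqrt (2 / D) <= 4 / D + eta.
Proof.
move=> D0 eta0 H; set K := Num.sqrt _.
have K0 : 0 <= K by exact: sqrtr_ge0.
have K2 : 4 / D = 2 * K ^+ 2.
  by rewrite sqr_sqrtr ?divr_ge0 ?(ltW D0)//; field; rewrite gt_eqF.
rewrite K2; case: H => [D2|eta1]; last by nra.
have K1 : 1 <= K by rewrite -sqrtr1 ler_wsqrtr// ler_pdivlMr// mul1r.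
nra.
Qed.

(* [la] nearly minimizes the left-hand side: [X ^+ 2] dominates
   [24 / Q ^+ 2 + 3 * L / D], the sum that the optimal choice has in place of
   [X ^+ 2]. *)
Lemma optimized_error_bound {R : realType} (D Q eta l lD L : R)
    (X := 2 * Num.sqrt (l / D) + 5 / Q) (la := (2 * X)^-1) (K := Num.sqrt (2 / D)) :
  2 <= D -> 0 < Q -> 0 < eta -> 0 <= l -> 2^-1 <= lD -> 3 * L <= 4 * l ->
  K * (eta + ((4 * la)^-1 + lD / Q + 24 * la / Q ^+ 2) + 3 * la * L / D + 2 / D ^+ 2)
  <= 2 * Num.sqrt (2 * l / D ^+ 2) + 11 * Num.sqrt 2 * lD / (Q * Num.sqrt D)
     + 4 / D + eta.
Proof.
move=> D2 Q0 eta0 l0 lD0 Ll.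
have D0 : 0 < D by lra.
have K0 : 0 <= K by exact: sqrtr_ge0.
have K1 : K <= 1 by rewrite -sqrtr1 ler_wsqrtr// ler_pdivrMr// mul1r.
have lD_ge0 : 0 <= l / D by rewrite divr_ge0// ltW.
set s := Num.sqrt (l / D).
have s0 : 0 <= s by exact: sqrtr_ge0.
have s2 : s ^+ 2 = l / D by rewrite sqr_sqrtr.
have Qi0 : 0 < Q^-1 by rewrite invr_gt0.
have X0 : 0 < X by rewrite /X -/s; lra.
(* The 5 in [X] is chosen so that its square exceeds 24; the 2 gives [4 * l / D], which covers
   [3 * L / D]. *)
have X2 : 24 / Q ^+ 2 + 3 * L / D <= X ^+ 2.
  have -> : X ^+ 2 = 4 * (l / D) + 20 * s / Q + 25 / Q ^+ 2.
    by rewrite /X -/s -s2; field; rewrite gt_eqF.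
  have h1 : 3 * L / D <= 4 * l / D by rewrite ler_pM2r ?invr_gt0.
  have h2 : 0 <= s / Q by rewrite mulr_ge0 ?(ltW Qi0).
  have h3 : 0 <= 1 / Q ^+ 2 by rewrite divr_ge0 ?exprn_ge0// ltW.
  lra.
have noise : (4 * la)^-1 + 24 * la / Q ^+ 2 + 3 * la * L / D <= X.
  have -> : (4 * la)^-1 + 24 * la / Q ^+ 2 + 3 * la * L / D =
    X - (X ^+ 2 - (24 / Q ^+ 2 + 3 * L / D)) / (2 * X).
    by rewrite /la; field; rewrite !gt_eqF.
  by rewrite lerBlDr lerDl divr_ge0 ?subr_ge0// mulr_ge0// ltW.
have Ks : K * s = Num.sqrt (2 * l / D ^+ 2).
  rewrite -sqrtrM ?divr_ge0 ?(ltW D0)//; congr Num.sqrt.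
  by field; rewrite gt_eqF.
have KE : K = Num.sqrt 2 / Num.sqrt D by rewrite /K sqrtrM// sqrtrV// ltW.
have -> : 11 * Num.sqrt 2 * lD / (Q * Num.sqrt D) = K * (11 * lD / Q).
  by rewrite KE; field; rewrite !gt_eqF ?sqrtr_gt0.
(* Source of the constant 11: [lD >= 2^-1] gives [5 <= 10 * lD]. *)
have lnQ : 5 / Q + lD / Q <= 11 * lD / Q.
  by rewrite -mulrDl ler_pM2r//; lra.
have DD : 2 / D ^+ 2 <= 4 / D.
  rewrite ler_pdivrMr ?exprn_gt0// (_ : 4 / D * D ^+ 2 = 4 * D); last first.
    by field; rewrite gt_eqF.
  lra.
have DD0 : 0 <= 2 / D ^+ 2 by rewrite divr_ge0 ?exprn_ge0// ltW.
apply: (@le_trans _ _ (K * (eta + X + lD / Q + 2 / D ^+ 2))).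
  by rewrite ler_wpM2l//; lra.
rewrite -Ks.
have h1 : K * eta <= eta by rewrite ler_piMl// ltW.
have h2 : K * (2 / D ^+ 2) <= 2 / D ^+ 2 by rewrite ler_piMl.
have h3 := ler_wpM2l K0 lnQ.
rewrite /X -/s; lra.
Qed.

Theorem theorem3 (R : realType) (d q m : nat) (eps eta : R)
  (v : 'I_q -> 'I_d -> R)
  (hd : (1 <= d)%N) (hq : (1 <= q)%N) (heps : 0 < eps) (heta : 0 < eta)
  (hm : 2 / eta = m%:R)
  (hv : forall j i, `| v j i | <= Num.sqrt (2 / d%:R)) :
  (h2_expected_error eps eta m (d ^ 2) v <=
    (2 * Num.sqrt (2 * ln (2 / eta) / (d%:R ^+ 2))
     + 11 * Num.sqrt 2 * ln d%:R / (q%:R * eps * Num.sqrt d%:R)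
     + 4 / d%:R + 2 * d%:R * expR (- (q%:R / 4)) + eta)%:E)%E.
Proof.
have meta : m%:R * eta = 2 by rewrite -hm divfK ?gt_eqF.
have d0 : 0 < d%:R :> R by rewrite ltr0n.
have q0 : 0 < q%:R :> R by rewrite ltr0n.
have T0 : (0 < d ^ 2)%N by rewrite expn_gt0 hd.
have m0 : (0 < m)%N by rewrite -(ltr0n R) -hm divr_gt0.
have l0 : 0 <= ln m%:R :> R by rewrite ln_ge0// ler1n.
have lD0 : 0 <= ln d%:R :> R by rewrite ln_ge0// ler1n.
have ex0 : 0 <= 2 * d%:R * expR (- (q%:R / 4)) :> R by rewrite !mulr_ge0 ?expR_ge0.
have dP0 := positive_dist_P0 (R := R) d m.
rewrite hm; apply: h2_expected_error_le => // c c0.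
have [triv|] := boolP ((d%:R <= 2 :> R) || (1 <= eta)).
  apply: (@le_trans _ _ (2 * Num.sqrt (2 / d%:R))%:E).
    apply: (run_exp_le_trivial _ heps hq hd T0 heta meta (N := 0) _ dP0 hv) => // i.
    by rewrite wP0 normr0 mul0r.
  have := trivial_error_bound d0 heta (orP triv).
  have h1 : 0 <= 2 * Num.sqrt (2 * ln m%:R / d%:R ^+ 2) :> R.
    by rewrite mulr_ge0 ?sqrtr_ge0.
  have h2 : 0 <= 11 * Num.sqrt 2 * ln d%:R / (q%:R * eps * Num.sqrt d%:R) :> R.
    by rewrite divr_ge0 ?mulr_ge0 ?sqrtr_ge0// ltW.
  by rewrite lee_fin; lra.
rewrite negb_or -!ltNge => /andP[d2 eta1].
have [y wqE] := wDQ_grid hd heta meta hv c0.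
have wDwq i := wD_wDQ_dist v c i hd heta.
have d3 : (2 <= d)%N by move: d2; rewrite ltr_nat; exact: ltnW.
have m3 : (3 <= m)%N.
  rewrite -(ltr_nat R) -(ltr_pM2r heta) meta; lra.
set Q := q%:R * eps; have Q0 : 0 < Q by rewrite mulr_gt0.
set X := 2 * Num.sqrt (ln m%:R / d%:R) + 5 / Q.
have la0 : 0 < (2 * X)^-1.
  by rewrite invr_gt0 mulr_gt0// ltr_wpDl ?mulr_ge0 ?sqrtr_ge0// divr_gt0.
apply: le_trans.
  exact: (run_exp_le_potential heps hq hd T0 heta meta wqE wDwq (N := 0) _ la0 _ dP0).
rewrite lee_fin.
have := @optimized_error_bound R d%:R Q eta (ln m%:R) (ln d%:R) (ln m.+1%:R)
  (ltW d2) Q0 heta l0 (half_le_ln d3) (ln_succ_le m3).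
set K := Num.sqrt (2 / d%:R) => main.
apply: le_trans (_ : _ <= K * (eta
   + ((4 * (2 * X)^-1)^-1 + ln d%:R / Q + 24 * (2 * X)^-1 / Q ^+ 2)
   + 3 * (2 * X)^-1 * ln m.+1%:R / d%:R + 2 / d%:R ^+ 2)) _; last first.
  by apply: le_trans main _; lra.
rewrite ler_wpM2l ?sqrtr_ge0//.
have -> : maxdev eta q (wDQ eta v c) 0 (fun _ : pt d m => 0) = 0.
  apply/eqP; rewrite eq_le maxdev_ge0 andbT; apply: bigmax_le => // i _.
  by rewrite wP0 mul0r subrr normr0 mul0r.
(* The initial potential [d%:R * ln m.+1%:R] divided by [T = d ^ 2] gives the term in
   [ln m.+1%:R / d%:R]. *)
rewrite potential_P0// natrX.
set M := maxdev _ _ _ _ _.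
have M0 : 0 <= M by exact: maxdev_ge0.
have MD : 0 <= M / d%:R ^+ 2 by rewrite divr_ge0 ?exprn_ge0.
(* The two sides differ exactly by the subtracted initial deviation [M], divided by [T]. *)
rewrite -/Q -subr_ge0 [leRHS](_ : _ = M / d%:R ^+ 2)//.
have X0 : X != 0 by rewrite gt_eqF//; move: la0; rewrite invr_gt0 pmulr_rgt0.
by field; rewrite X0 !gt_eqF.
Qed.
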